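(* There exists a minimal free continuous action $\alpha: \mathbb{Z}^2\curvearrowright X$ on the Cantor set $X$ with topological entropy $h_{\operatorname{top}}(X, \mathbb{Z}^2)=0$ such that the topological full group $[[\alpha]]$ contains a non-abelian free group as a subgroup.
   Context: The topological full group $[[\alpha]]$ of an action $\alpha:G\curvearrowright X$ of a countable discrete group on the Cantor set is the group of all homeomorphisms $\varphi: X\to X$ for which there is a continuous map $c: X\to G$ ($G$ discrete) with $\varphi(x)=\alpha_{c(x)}(x)$ for all $x\in X$. An action is minimal if every orbit is dense, and free if $gx\neq x$ for every $x\in X$ and every $g\neq e$. *)

(* Defs.v *)
From HB Require Import structures.
From mathcomp Require Import all_boot all_order all_algebra.
From mathcomp Require Import all_classical all_reals all_analysis.

Set Implicit Arguments.
Unset Strict Implicit.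
Unset Printing Implicit Defensive.

Import Order.TTheory GRing.Theory Num.Theory.
Import numFieldNormedType.Exports.

Local Open Scope classical_set_scope.
Local Open Scope ring_scope.

Definition homeomorphism (X Y : topologicalType) (f : X -> Y) : Prop :=
  continuous f /\
  exists2 g : Y -> X, continuous g & cancel f g /\ cancel g f.

Definition is_cantor_set (X : topologicalType) : Prop :=
  exists f : X -> cantor_space, homeomorphism f.

(* The acting group is written additively and is regarded as discrete, so      *)
(* joint continuity of the action amounts to continuity of each translation.   *)
Record cts_action (G : zmodType) (X : topologicalType) := CtsAction {
  act :> G -> X -> X;
  act0 : forall x, act 0 x = x;
  actD : forall g h x, act (g + h) x = act g (act h x);
  act_continuous : forall g, continuous (act g) }.

Definition minimal_action (G : zmodType) (X : topologicalType)
    (alpha : cts_action G X) : Prop :=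
  forall x, dense (range (fun g => alpha g x)).

Definition free_action (G : zmodType) (X : topologicalType)
    (alpha : cts_action G X) : Prop :=
  forall (g : G) (x : X), g <> 0 -> alpha g x <> x.

Definition in_full_group (G : zmodType) (X : topologicalType)
    (alpha : cts_action G X) : set (X -> X) :=
  [set f | homeomorphism f /\
    exists2 c : X -> discrete_topology G, continuous c &
      forall x, f x = alpha (c x) x].

Definition full_group (G : zmodType) (X : topologicalType)
    (alpha : cts_action G X) : Type := {f : X -> X | in_full_group alpha f}.

Section full_group_theory.
Context {G : zmodType} {X : topologicalType} {alpha : cts_action G X}.
Implicit Types f g h : full_group alpha.

HB.instance Definition _ := gen_eqMixin (full_group alpha).
HB.instance Definition _ := gen_choiceMixin (full_group alpha).

Lemma full_group_inj f g : sval f =1 sval g -> f = g.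
Proof.
case: f g => f Pf [g Pg] /= /funext fg.
by subst g; congr exist; exact: Prop_irrelevance.
Qed.

Lemma continuous_discreteP (c : X -> discrete_topology G) :
  continuous c <-> forall x, \forall y \near x, c y = c x.
Proof.
split=> [cc x|cc x].
- have /discrete_cvg := cc x; exact.
- by apply/discrete_cvg; exact: cc.
Qed.

Lemma in_full_group_id : in_full_group alpha idfun.
Proof.
split; first by split=> [x|]; [exact: cvg_id|exists idfun => // x; exact: cvg_id].
exists (fun=> 0) => [|x]; last by rewrite act0.
by apply/continuous_discreteP => x; near=> y.
Unshelve. all: by end_near. Qed.

Lemma in_full_group_comp (f g : X -> X) : in_full_group alpha f ->
  in_full_group alpha g -> in_full_group alpha (f \o g).
Proof.
move=> [[cf [f' cf' [fK f'K]]] [c /continuous_discreteP cc fE]].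
move=> [[cg [g' cg' [gK g'K]]] [d /continuous_discreteP dc gE]].
split.
  split=> [x|]; first exact: continuous_comp (cg _) (cf _).
  exists (g' \o f') => [x|]; first exact: continuous_comp (cf' _) (cg' _).
  by split; exact: can_comp.
exists (fun x => (c (g x) : G) + d x) => [|x] /=; last by rewrite actD -gE -fE.
apply/continuous_discreteP => x.
have cgx : \forall y \near x, c (g y) = c (g x) by exact: cg (cc (g x)).
by near=> y; congr +%R; [near: y | near: y; exact: dc].
Unshelve. all: by end_near. Qed.

Lemma in_full_group_inv (f g : X -> X) : in_full_group alpha f ->
  continuous g -> cancel f g -> cancel g f -> in_full_group alpha g.
Proof.
move=> [[cf _] [c /continuous_discreteP cc fE]] cg fK gK.
split; first by split=> //; exists f.
exists (fun x => - (c (g x) : G)) => [|x]; last first.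
  by rewrite -{3}(gK x) fE -actD addNr act0.
apply/continuous_discreteP => x.
have cgx : \forall y \near x, c (g y) = c (g x) by exact: cg (cc (g x)).
by near=> y; congr -%R; near: y.
Unshelve. all: by end_near. Qed.

Definition full_group_one : full_group alpha := exist _ _ in_full_group_id.

Definition full_group_mul f g : full_group alpha :=
  exist _ _ (in_full_group_comp (svalP f) (svalP g)).

Lemma full_group_inverse f :
  exists g, full_group_mul g f = full_group_one /\
            full_group_mul f g = full_group_one.
Proof.
have [[_ [g cg [fK gK]]] _] := svalP f.
exists (exist _ g (in_full_group_inv (svalP f) cg fK gK)).
by split; apply: full_group_inj => x /=; rewrite ?fK ?gK.
Qed.

Definition full_group_inv f : full_group alpha := sval (cid (full_group_inverse f)).

Lemma full_group_mulA : associative full_group_mul.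
Proof. by move=> f g h; exact: full_group_inj. Qed.

Lemma full_group_mul1 : left_id full_group_one full_group_mul.
Proof. by move=> f; exact: full_group_inj. Qed.

Lemma full_group_mulr1 : right_id full_group_one full_group_mul.
Proof. by move=> f; exact: full_group_inj. Qed.

Lemma full_group_mulV :
  left_inverse full_group_one full_group_inv full_group_mul.
Proof. by move=> f; rewrite /full_group_inv; case: cid => g []. Qed.

Lemma full_group_mulrV :
  right_inverse full_group_one full_group_inv full_group_mul.
Proof. by move=> f; rewrite /full_group_inv; case: cid => g []. Qed.

HB.instance Definition _ := isGroup.Build (full_group alpha)
  full_group_mulA full_group_mul1 full_group_mulr1
  full_group_mulV full_group_mulrV.

End full_group_theory.

Definition free_basis (F : groupType) (S : set F) : Prop :=
  forall (K : groupType) (f : F -> K),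
    exists2 h : {multiplicative F -> K},
      forall s, S s -> h s = f s &
      forall h' : {multiplicative F -> K},
        (forall s, S s -> h' s = f s) -> h' =1 h.

Definition free_group (F : groupType) : Prop :=
  exists S : set F, free_basis S.

Definition abelian_group (F : groupType) : Prop :=
  forall x y : F, commute x y.

Definition embeds_in (F H : groupType) : Prop :=
  exists f : {multiplicative F -> H}, injective f.

Definition open_cover (X : topologicalType) : set (set (set X)) :=
  [set U | U `<=` open /\ \bigcup_(A in U) A = [set: X]].

(* The least cardinality of a finite subcover; as a real infimum it is attained *)
(* whenever U has a finite subcover, in particular when X is compact.           *)
Definition cover_number (R : realType) (X : topologicalType)
    (U : set (set X)) : R :=
  inf [set n%:R | n in [set n : nat | exists V : set (set X),
    [/\ V `<=` U, (V #= `I_n)%card & \bigcup_(A in V) A = [set: X]]]].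

(* The join of the covers alpha_g^-1(U) for g in F.                            *)
Definition cover_join (G : zmodType) (X : topologicalType)
    (alpha : cts_action G X) (F : set G) (U : set (set X)) : set (set X) :=
  [set \bigcap_(g in F) (alpha g @^-1` A g) |
     A in [set A : G -> set X | forall g, F g -> U (A g)]].

Definition box (n : nat) : set (int * int) :=
  [set g | (0 <= g.1 < n%:Z) && (0 <= g.2 < n%:Z)].

(* The limit superior is a limit by subadditivity.                             *)
Definition cover_entropy (R : realType) (X : topologicalType)
    (alpha : cts_action (int * int)%type X) (U : set (set X)) : \bar R :=
  limn_esup (fun n : nat =>
    (ln (cover_number R (cover_join alpha (box n) U)) / (n ^ 2)%N%:R)%:E).

Definition topological_entropy (R : realType) (X : topologicalType)
    (alpha : cts_action (int * int)%type X) : \bar R :=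
  ereal_sup [set cover_entropy R alpha U | U in @open_cover X].

(* Main.v *)
Require Import Defs.
From HB Require Import structures.
From mathcomp Require Import all_boot all_order all_algebra.
From mathcomp Require Import all_classical all_reals all_analysis.
From mathcomp Require Import zify ring.

(** The action is the translation action on the orbit closure (the hull) of one
array on Z^2. Minimality and zero entropy want the array to be very orderly; a
free group in the full group wants it to contain every word. In dimension two
both fit, because each word can be given a whole column of its own.

The array. Write n(i) for the exponent of 3 in 2i+1; it is finite for every
integer i, since 2i+1 is never 0, and it takes every value. Column i repeats
vertically, with period 3^n(i), the base 5 digits of the number n(i), read as a
word in four marks and a blank. The array also records the residues of i and j
modulo all powers of 3. Every single bit of it is then constant along a coset
of some 3^m Z^2 ([obs_toeplitz]), which makes the hull minimal
([hull_minimal]); the residues make the action free ([obs_separating],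
[hull_free]). A hull with both properties is compact, metrizable,
zero-dimensional and without isolated points, so it is a Cantor set
([hull_cantor]).

Entropy. In a window of side m the position of the window modulo 3^m determines
every column with n(i) < m. The other columns satisfy 3^m | 2i+1, and a window
of that size meets at most one of them. So a window has at most 9^m position
classes times 5^m contents of the exceptional column: exponential in the side,
not in the area ([obs_low_complexity], [hull_entropy]).

The free group. Each of the four marks gives an involution in the full group:
it exchanges two vertically adjacent places whose common edge carries that
mark, provided the next edges above and below do not ([swap]). If a column
spells a word in the marks with distinct adjacent letters, applying the
corresponding involutions in turn walks along the word, one step per letter
([spells_walk]), so their product is not the identity. With a, b, c, d the four
involutions, a reduced word in ab and cd is, letter by letter, such a word in
the marks ([sorted_marks]), and every word of marks occurs in a column
([obs_spells]). Hence no nonempty reduced word in ab and cd is trivial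
([swap_gen_free]), and two elements with this property generate a free group
([generated_free]). *)

Set Implicit Arguments.
Unset Strict Implicit.
Unset Printing Implicit Defensive.

Import Order.TTheory GRing.Theory Num.Theory.
Import numFieldNormedType.Exports.

Local Open Scope classical_set_scope.
Local Open Scope ring_scope.

Local Notation Z2 := (int * int)%type.

(** * Cylinders of the Cantor space *)

Definition agree (N : nat) (x y : nat -> bool) : Prop :=
  forall c, (c < N)%N -> x c = y c.

Lemma agree_sym N x y : agree N x y -> agree N y x.
Proof. by move=> xy c cN; rewrite xy. Qed.

Lemma agree_trans N x y z : agree N x y -> agree N y z -> agree N x z.
Proof. by move=> xy yz c cN; rewrite xy ?yz. Qed.

Lemma agree_le M N x y : (N <= M)%N -> agree M x y -> agree N x y.
Proof. by move=> NM xy c cN; apply: xy; exact: leq_trans NM. Qed.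

Lemma cantor_nbhsP (x : cantor_space) (U : set cantor_space) :
  nbhs x U <-> exists N, forall y, agree N x y -> U y.
Proof.
split.
- have FF : Filter (filter_from [set: nat] (fun N => [set y | agree N x y])).
    apply: filter_from_filter; first by exists 0%N.
    move=> i j _ _; exists (maxn i j) => // y xy.
    by split; apply: agree_le xy; rewrite ?leq_maxl ?leq_maxr.
  have : filter_from [set: nat] (fun N => [set y | agree N x y]) --> x.
    apply/cvg_sup => i V [W [[Q oQ <-] Qx OV]].
    by apply: (filterS OV); rewrite nbhs_simpl /=; exists i.+1 => // y /= <-.
  by move=> /[apply]; rewrite nbhs_simpl => -[N _ NU]; exists N.
- case=> N NU.
  have : nbhs x [set y | agree N x y].
    elim: N {NU} => [|N IH]; first by apply: filterS filterT => y _ c.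
    have : nbhs x [set y : cantor_space | y N = x N].
      apply: (@proj_continuous nat (fun=> bool) N x [set x N]).
      by apply: open_nbhs_nbhs; split => //; exact: discrete_open.
    apply: filter_app; apply: filterS IH => y xy /= yN c.
    by rewrite ltnS leq_eqVlt => /predU1P[->|/xy].
  by apply: filterS => y; exact: NU.
Qed.

(** * The hull of a family of observables *)

Section Hull.
Context (B : countType) (b : B -> Z2 -> bool).

(** The array seen from [g]. The bit of observable [k] at place [h] sits at the
coordinate [pickle (h, k)], so that the hull is a subset of [cantor_space];
coordinates that code no pair are constantly false. *)
Definition orb (g : Z2) : cantor_space := fun c =>
  if @pickle_inv (Z2 * B)%type c is Some (h, k) then b k (h + g) else false.

Definition translate (g : Z2) (x : cantor_space) : cantor_space := fun c =>
  if @pickle_inv (Z2 * B)%type c is Some (h, k) then x (pickle (h + g, k))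
  else x c.

Definition read (x : nat -> bool) (h : Z2) (k : B) : bool := x (pickle (h, k)).

Lemma read_orb g h k : read (orb g) h k = b k (h + g).
Proof. by rewrite /read /orb pickleK_inv. Qed.

Lemma read_translate g x h k : read (translate g x) h k = read x (h + g) k.
Proof. by rewrite /read /translate pickleK_inv. Qed.

Lemma translate_orb g g' : translate g (orb g') = orb (g + g').
Proof.
apply/funext => c; rewrite /translate /orb.
case E: (pickle_inv c) => [[h k]|] //; by rewrite pickleK_inv addrA.
Qed.

Lemma translate0 x : translate 0 x = x.
Proof.
apply/funext => c; rewrite /translate.
have := @pickle_invK (Z2 * B)%type c.
by case: (pickle_inv c) => [[h k]|] //= <-; rewrite addr0.
Qed.

Lemma translateD g g' x : translate (g + g') x = translate g (translate g' x).
Proof.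
apply/funext => c; rewrite /translate.
case E: (pickle_inv c) => [[h k]|] //; by rewrite pickleK_inv addrA.
Qed.

(** Uniform continuity: the modulus depends only on the translation. *)
Lemma translate_agree g N : exists M, forall x y,
  agree M x y -> agree N (translate g x) (translate g y).
Proof.
pose next c := if @pickle_inv (Z2 * B)%type c is Some (h, k)
  then pickle (h + g, k) else c.
exists (\max_(c < N) (next c).+1)%N => x y xy c cN.
have : x (next c) = y (next c).
  by apply: xy; apply: (leq_bigmax (Ordinal cN)).
by rewrite /next /translate; case: (pickle_inv c) => [[]|].
Qed.

Lemma translate_agree_seq (S : seq Z2) N : exists M, forall x y, agree M x y ->
  forall g, g \in S -> agree N (translate g x) (translate g y).
Proof.
elim: S => [|g S [M HM]]; first by exists 0%N.
have [M' HM'] := translate_agree g N.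
exists (maxn M M') => x y xy h; rewrite inE => /predU1P[->|hS].
  by apply: HM'; apply: agree_le xy; rewrite leq_maxr.
by apply: HM hS; apply: agree_le xy; rewrite leq_maxl.
Qed.

Definition hull : set cantor_space :=
  [set x | forall N, exists g, agree N x (orb g)].

Lemma hull_orb g : hull (orb g).
Proof. by move=> N; exists g. Qed.

Lemma hull_translate g x : hull x -> hull (translate g x).
Proof.
move=> hx N; have [M HM] := translate_agree g N.
by have [g' /HM] := hx M; rewrite translate_orb => ?; exists (g + g').
Qed.

Lemma hull_closed : closed hull.
Proof.
move=> x clx N; have [|y [hy xy]] := clx [set y | agree N x y].
  by apply/cantor_nbhsP; exists N.
by have [g yg] := hy N; exists g; exact: agree_trans xy yg.
Qed.

Local Notation X := (set_type hull).

Definition hull_pt (g : Z2) : X := exist _ (orb g) (mem_set (hull_orb g)).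

Lemma hullP (x : X) : hull (val x).
Proof. exact: set_mem (valP x). Qed.

Definition hull_act (g : Z2) (x : X) : X :=
  exist _ (translate g (val x)) (mem_set (hull_translate g (hullP x))).

(** All topology on the hull goes through this description of neighbourhoods. *)
Lemma hull_nbhsP (x : X) (U : set X) :
  nbhs x U <-> exists N, forall y : X, agree N (val x) (val y) -> U y.
Proof.
split.
- case=> W [[Q oQ <-] Qx QU].
  have /cantor_nbhsP[N HN] : nbhs (val x : cantor_space) Q.
    by apply: open_nbhs_nbhs.
  by exists N => y /HN Qy; apply: QU.
- case=> N HN.
  have : nbhs (val x : cantor_space) [set y | agree N (val x) y].
    by apply/cantor_nbhsP; exists N.
  rewrite nbhsE => -[Q [oQ Qx] QU].
  exists (val @^-1` Q); split => //; first by exists Q.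
  by move=> y /= Qy; apply: HN; exact: QU.
Qed.

Lemma hull_continuousP (f : X -> X) :
  (forall N x, exists M, forall y : X, agree M (val x) (val y) ->
     agree N (val (f x)) (val (f y))) -> continuous f.
Proof.
move=> H x U /hull_nbhsP[N HN]; have [M HM] := H N x.
by apply/hull_nbhsP; exists M => y /HM; exact: HN.
Qed.

Lemma hull_act_continuous g : continuous (hull_act g).
Proof.
apply: hull_continuousP => N x; have [M HM] := translate_agree g N.
by exists M => y; exact: HM.
Qed.

Lemma hull_act0 x : hull_act 0 x = x.
Proof. by apply: val_inj; rewrite /= translate0. Qed.

Lemma hull_actD g h x : hull_act (g + h) x = hull_act g (hull_act h x).
Proof. by apply: val_inj; rewrite /= translateD. Qed.

Definition hull_action : cts_action Z2 X :=
  CtsAction hull_act0 hull_actD hull_act_continuous.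

Lemma hull_action_pt g h : hull_action g (hull_pt h) = hull_pt (g + h).
Proof. by apply: val_inj; rewrite /= translate_orb. Qed.

Lemma hull_compact : compact [set: X].
Proof.
have cA : compact hull.
  apply: (subclosed_compact _ cantor_space_compact) => //; exact: hull_closed.
move=> F PF FT.
have PG : ProperFilter ((val : X -> cantor_space) @ F).
  exact: fmap_proper_filter.
have [|x [hx cx]] := cA _ PG.
  by rewrite /fmap /=; apply: filterS FT => y _; exact: hullP.
exists (exist _ x (mem_set hx)); split => // P Q FP /hull_nbhsP[N HN].
have [_ [[y Py <-] xy]] :
    ((val : X -> cantor_space) @` P) `&` [set y | agree N x y] !=set0.
  apply: cx; last by apply/cantor_nbhsP; exists N.
  by rewrite /fmap /=; apply: filterS FP => y Py; exists y.
by exists y; split => //; exact: HN.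
Qed.

Lemma hull_neq (x y : X) : x <> y -> exists c, val x c <> val y c.
Proof.
move=> xy; apply: contra_notP xy => /forallNP H; apply: val_inj.
by apply/funext => c; exact: contrapT.
Qed.

Lemma hull_open_coord c v : open [set x : X | val x c = v].
Proof.
rewrite openE => x /= <-; apply/hull_nbhsP; exists c.+1 => y xy /=.
by rewrite xy.
Qed.

Lemma hull_zero_dimensional : zero_dimensional X.
Proof.
move=> x y /eqP/hull_neq[c cxy].
exists [set z : X | val z c = val x c]; split => //; last by move=> /esym.
split; first exact: hull_open_coord.
rewrite -[X in closed X]setCK; apply: open_closedC.
rewrite (_ : ~` _ = [set z : X | val z c = ~~ val x c]); first exact: hull_open_coord.
by apply/seteqP; split=> z /=; case: (val z c); case: (val x c).
Qed.

End Hull.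

(** * Recognizing Cantor sets *)

Section CantorLike.
Context (R : realType) (T : pseudoMetricType R) (p : T).

(** An alias, so that choosing the base point [p] leaves the structure of [T]
untouched. *)
Definition pointed_copy : Type := T.
HB.instance Definition _ := PseudoMetric.on pointed_copy.
HB.instance Definition _ := isPointed.Build pointed_copy p.

(** The characterization of Cantor-like spaces yields a continuous closed
bijection from the Cantor space; closedness is the continuity of its inverse. *)
Lemma cantor_like_is_cantor_set : cantor_like T -> is_cantor_set T.
Proof.
move=> cT; have [f [cf clf]] := @homeomorphism_cantor_like R pointed_copy cT.
have [g fK gK] : bijective f by rewrite -setTT_bijective; exact: bij.
exists g.
split; last by exists f.
apply/continuous_closedP => A clA.
rewrite (_ : g @^-1` A = f @` A); first exact: clf.
by apply/seteqP; split=> [x /= gA|_ [x Ax <-]] /=; [exists (g x)|rewrite fK].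
Qed.

End CantorLike.

(** * Minimality, freeness and absence of isolated points *)

Definition box_seq (n : nat) : seq Z2 :=
  [seq (i%:Z, j%:Z) | i <- iota 0 n, j <- iota 0 n].

Lemma mem_box_seq n g : g \in box_seq n <-> box n g.
Proof.
split=> [/allpairsP[[i j] /= [] ]|].
  by rewrite !mem_iota /= !add0n => i_n j_n ->; rewrite /box /= !ltz_nat i_n.
case: g => -[i|i] [j|j]; rewrite /box //= !ltz_nat ?andbF // => /andP[i_n j_n].
by apply/allpairsP; exists (i, j); rewrite /= !mem_iota.
Qed.

Lemma box_residue (m : nat) (a : Z2) : (0 < m)%N ->
  exists2 s, s \in box_seq m & exists h, s = a + h *+ m.
Proof.
case: a => a1 a2 m_gt0; exists ((a1 %% m)%Z, (a2 %% m)%Z).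
  apply/mem_box_seq; rewrite /box /= !modz_ge0 ?ltz_pmod //; lia.
have modE (c : int) : (c %% m)%Z = c + (- (c %/ m)%Z) *+ m.
  by rewrite -mulr_natr natz mulNr [X in X - _](divz_eq c m) addrC addKr.
exists (- (a1 %/ m)%Z, - (a2 %/ m)%Z).
by rewrite !modE pairMnE.
Qed.

(** Each bit of the array recurs along a coset of a finite index subgroup; the
period may depend on the place. *)
Definition toeplitz (B : Type) (b : B -> Z2 -> bool) :=
  forall k g, exists2 m : nat, (0 < m)%N & forall h, b k (g + h *+ m) = b k g.

(** The finite list of observables that tells [g] from [a + g] must be uniform in
[g] for the non-periodicity to pass to limits of translates. *)
Definition separating (B : eqType) (b : B -> Z2 -> bool) :=
  forall a, a <> 0 -> exists S : seq B, forall g,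
    exists2 k, k \in S & b k (a + g) <> b k g.

Lemma zero_dimensional_hausdorff (T : topologicalType) :
  zero_dimensional T -> hausdorff_space T.
Proof.
move=> zT x y clxy; apply/eqP/negPn/negP => /zT[U [[oU cU] Ux nUy]].
have [z [Uz nUz]] : U `&` ~` U !=set0; last exact: nUz.
apply: clxy; apply: open_nbhs_nbhs; split => //; exact: closed_openC.
Qed.

Section Dynamics.
Context (B : countType) (b : B -> Z2 -> bool).
Local Notation X := (set_type (hull b)).
Local Notation orb := (orb b).
Local Notation alpha := (hull_action b).
Local Notation pt := (hull_pt b).

Lemma hull_read (x : X) (S : seq (Z2 * B)) :
  exists g, forall h k, (h, k) \in S -> read (val x) h k = b k (h + g).
Proof.
have [g xg] := hullP x (\max_(c <- S) (pickle c).+1)%N.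
exists g => h k hk; rewrite -read_orb; apply: xg.
by rewrite (big_rem _ hk) /= leq_maxl.
Qed.

(** A fixed point of [a] looks locally like the array around some place [g], where
one of finitely many observables distinguishes [g] from [a + g]. *)
Lemma hull_free : separating b -> free_action alpha.
Proof.
move=> sep a x a0 ax; have [S HS] := sep _ a0.
have [g xg] := hull_read x ([seq (0, k) | k <- S] ++ [seq (a, k) | k <- S]).
have [k kS] := HS g; apply.
rewrite -xg; last by rewrite mem_cat map_f ?orbT.
rewrite -[in RHS](add0r g) -xg; last by rewrite mem_cat map_f.
by rewrite -[in RHS]ax /= read_translate add0r.
Qed.

(** Finitely many bits have a common period, the product of their periods. *)
Lemma orb_periodic : toeplitz b -> forall N g,
  exists2 m, (0 < m)%N & forall h, agree N (orb (g + h *+ m)) (orb g).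
Proof.
move=> tb N g; elim: N => [|N [m m0 IH]]; first by exists 1%N.
have [m' m'0 Hm'] : exists2 m', (0 < m')%N &
    forall h, orb (g + h *+ m') N = orb g N.
  rewrite /orb; case: (pickle_inv N) => [[h k]|]; last by exists 1%N.
  have [m' m'0 H] := tb k (h + g); exists m' => // h'.
  by rewrite addrA H.
exists (m * m')%N => [|h c]; first by rewrite muln_gt0 m0.
rewrite ltnS leq_eqVlt => /predU1P[->|cN].
  by rewrite mulrnA Hm'.
by rewrite mulnC mulrnA IH.
Qed.

(** A pattern of the array recurs along [g + m Z^2], and any point copies the
array on a window large enough to contain a representative of that coset, so
its orbit visits every cylinder. *)
Lemma hull_minimal : toeplitz b -> minimal_action alpha.
Proof.
move=> tb x U [y Uy] oU.
have /hull_nbhsP[N HN] : nbhs y U by apply: open_nbhs_nbhs.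
have [g yg] := hullP y N; have [m m0 gm] := orb_periodic tb N g.
have [M HM] := translate_agree_seq B (box_seq m) N.
have [g' xg'] := hullP x M.
(* a translation [s] in the box that moves [g'] into the coset of [g] *)
have [s sm [h sE]] := box_residue (g - g') m0.
exists (alpha s x); split; last by exists s.
apply: HN; apply: (agree_trans yg); apply: agree_sym.
apply: agree_trans (HM _ _ xg' s sm) _.
by rewrite translate_orb sE addrAC subrK; exact: gm.
Qed.

Lemma pt_inj : separating b -> injective pt.
Proof.
move=> sep g g' gg'; apply/eqP; rewrite -subr_eq0; apply/negPn/negP => /eqP ng.
by apply: (hull_free sep (x := pt g') ng); rewrite hull_action_pt subrK.
Qed.

(** Periodicity puts two points of the orbit of the array, distinct by freeness,
in every nonempty open set. *)
Lemma hull_perfect : toeplitz b -> separating b -> perfect_set [set: X].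
Proof.
move=> tb sep; apply/perfectTP_ex => U oU [x Ux].
have /hull_nbhsP[N HN] : nbhs x U by apply: open_nbhs_nbhs.
have [g xg] := hullP x N; have [m m0 gm] := orb_periodic tb N g.
exists (pt g), (pt (g + (1, 0) *+ m)); split.
- exact: HN.
- by apply: HN; apply: (agree_trans xg); apply: agree_sym; exact: gm.
apply/eqP => /(pt_inj sep)/eqP; rewrite -subr_eq0 opprD addNKr oppr_eq0.
by rewrite pairMnE xpair_eqE /= pmulrn mulrz_eq0 !oner_eq0 orbF; lia.
Qed.

Lemma hull_cantor (R : realType) :
  toeplitz b -> separating b -> is_cantor_set X.
Proof.
move=> tb sep.
apply: (@cantor_like_is_cantor_set R X (pt 0)); split.
- exact: hull_perfect.
- exact: hull_compact.
- by apply: zero_dimensional_hausdorff; exact: hull_zero_dimensional.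
- exact: hull_zero_dimensional.
Qed.

End Dynamics.

(** * Zero entropy from few patterns *)

Section CoverNumber.
Context (R : realType) (T : topologicalType).
Implicit Types (U : set (set T)).

Lemma card_le_range_ord (k : nat) (W : 'I_k -> set T) : (range W #<= `I_k)%card.
Proof. by rewrite (card_le_eqr card_II); exact: card_image_le. Qed.

Lemma cover_number_le U (k : nat) (W : 'I_k -> set T) :
  range W `<=` U -> \bigcup_d W d = [set: T] -> cover_number R U <= k%:R.
Proof.
move=> WU Wcov; have lek := card_le_range_ord W.
have /finite_setP[n Wn] : finite_set (range W) by apply/finite_set_leP; exists k.
have nk : (n <= k)%N by rewrite -card_le_II -(card_le_eql Wn).
apply: (@le_trans _ _ n%:R); last by rewrite ler_nat.
apply: ge_inf; first by exists 0 => _ [m _ <-].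
exists n => //; exists (range W); split => //.
by rewrite bigcup_image.
Qed.

Lemma cover_number_ge1 U (p : T) (k : nat) (W : 'I_k -> set T) :
  range W `<=` U -> \bigcup_d W d = [set: T] -> 1 <= cover_number R U.
Proof.
move=> WU Wcov; apply: lb_le_inf.
  have /finite_setP[n Wn] : finite_set (range W).
    by apply/finite_set_leP; exists k; exact: card_le_range_ord.
  by exists n%:R, n => //; exists (range W); split => //; rewrite bigcup_image.
move=> _ [n [V [_ Vn Vcov]] <-]; rewrite ler1n lt0n; apply/negP => /eqP n0.
have : [set: T] p by []; rewrite -Vcov => -[A VA _].
by move: Vn; rewrite n0 II0 card_eq0 => /eqP V0; rewrite V0 in VA.
Qed.

End CoverNumber.

(** The patterns seen by finitely many observables in a box of side [n] are
determined by [data], whose number of values is exponential in the side. *)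
Definition low_complexity (B : eqType) (b : B -> Z2 -> bool) :=
  forall S : seq (Z2 * B), exists K c : nat, forall n, exists (D : finType)
    (data : Z2 -> D), (#|D| <= K.+1 ^ (n + c))%N /\
    forall g g', data g = data g' -> forall h, box n h ->
      forall u k, (u, k) \in S -> b k (u + (h + g)) = b k (u + (h + g')).

Lemma cvg_linear_over_square (R : realType) (c : nat) (a : R) : 0 <= a ->
  (n + c)%:R * a / (n ^ 2)%N%:R @[n --> \oo] --> 0.
Proof.
move=> a0.
apply: (@squeeze_cvgr _ _ _ _ (fun=> 0) (fun n => (2 * c.+1)%:R * a * harmonic n)).
- near=> n; have n_gt0 : (0 < n)%N by near: n; exists 1%N.
  rewrite divr_ge0 ?mulr_ge0 //= [leRHS]mulrAC [leLHS]mulrAC ler_wpM2r //.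
  rewrite ler_pdivrMr ?ltr0n ?expn_gt0 ?n_gt0 // mulrAC ler_pdivlMr ?ltr0n //.
  by rewrite -!natrM ler_nat; nia.
- exact: cvg_cst.
- rewrite -[0](mulr0 ((2 * c.+1)%:R * a)).
  by apply: cvgM; [exact: cvg_cst|exact: cvg_harmonic].
Unshelve. all: by end_near. Qed.

Section Entropy.
Context (B : countType) (b : B -> Z2 -> bool).
Local Notation X := (set_type (hull b)).
Local Notation alpha := (hull_action b).
Local Notation pt := (hull_pt b).

(** Otherwise there are points [x N] whose [N]-cylinders lie in no member of the
cover; a cluster point of them lies in some member, which contains one of these
cylinders. *)
Lemma lebesgue_number (U : set (set X)) : open_cover U ->
  exists N, forall x : X, exists2 A, U A &
    forall y : X, agree N (val x) (val y) -> A y.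
Proof.
move=> [oU Ucov]; apply: contrapT => /forallNP H.
have {}H N : exists x : X, ~ exists2 A, U A &
    forall y : X, agree N (val x) (val y) -> A y.
  by have /existsNP := H N.
have [x xP] := choice H.
have [z [_ clz]] := @hull_compact _ b (x @ \oo) _ filterT.
have [A UA Az] : (\bigcup_(A in U) A) z by rewrite Ucov.
have /hull_nbhsP[N HN] : nbhs z A.
  by apply: open_nbhs_nbhs; split => //; exact: oU.
have [y [[n /= Nn <-] zy]] :
    (x @` [set n | (N <= n)%N]) `&` [set y | agree N (val z) (val y)] !=set0.
  apply: clz; last by apply/hull_nbhsP; exists N.
  by exists N => // n Nn; exists n.
apply: (xP n); exists A => // y' xy'; apply: HN.
by apply: (agree_trans zy); apply: agree_le xy'.
Qed.

(** Places with the same [data] give arrays that agree on the Lebesgue number of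
bits after every translation in the box. One member of the joint cover,
attached to one representative place for each value of [data], therefore
contains all points of the hull that look like such a place. *)
Lemma hull_cover_number (R : realType) (U : set (set X)) : low_complexity b ->
  open_cover U -> exists K c : nat, forall n,
    1 <= cover_number R (cover_join alpha (box n) U) <= (K.+1 ^ (n + c))%N%:R.
Proof.
move=> lowb Ucov; have [N HN] := lebesgue_number Ucov.
have {}HN (g : Z2) : exists A, U A /\
    forall y : X, agree N (orb b g) (val y) -> A y.
  by have [A] := HN (pt g); exists A.
have [A AP] := choice HN.
have [K [c Kc]] := lowb (pmap (@pickle_inv (Z2 * B)%type) (iota 0 N)).
exists K, c => n; have [D [data [Dle dataP]]] := Kc n.
have [rep repP] : exists rep : D -> Z2, forall g, data (rep (data g)) = data g.
  have /choice[rep repP] d : exists r, (exists g, data g = d) -> data r = d.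
    by have [[g gd]|nd] := pselect (exists g, data g = d); [exists g|exists 0].
  by exists rep => g; apply: repP; exists g.
pose W (d : 'I_#|D|) : set X :=
  \bigcap_(h in box n) (alpha h @^-1` A (h + rep (enum_val d))).
have WU : range W `<=` cover_join alpha (box n) U.
  move=> _ [d _ <-]; exists (fun h => A (h + rep (enum_val d))) => //= h _.
  by have [] := AP (h + rep (enum_val d)).
have Wcov : \bigcup_d W d = [set: X].
  apply/seteqP; split=> // x _.
  have [M HM] := translate_agree_seq B (box_seq n) N.
  have [g xg] := hullP x M.
  exists (enum_rank (data g)) => // h hn; rewrite enum_rankK /=.
  have [_] := AP (h + rep (data g)); apply => /=.
  apply: agree_sym; apply: agree_trans (HM _ _ xg h _) _.
    exact/mem_box_seq.
  rewrite translate_orb => i iN; rewrite /orb.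
  case E: (pickle_inv i) => [[u k]|] //.
  apply: dataP hn _ _ _; first by rewrite repP.
  by rewrite mem_pmap -E map_f // mem_iota.
apply/andP; split.
  exact: (cover_number_ge1 R (pt 0) WU Wcov).
apply: le_trans (cover_number_le R WU Wcov) _.
by rewrite ler_nat.
Qed.

Lemma hull_entropy (R : realType) : low_complexity b ->
  topological_entropy R alpha = 0%E.
Proof.
move=> lowb; rewrite /topological_entropy.
rewrite (_ : [set _ | _ in _] = [set 0%E]) ?ereal_sup1 //.
have cov0 U : open_cover U -> cover_entropy R alpha U = 0%E.
  move=> /(hull_cover_number R lowb)[K [c Kc]].
  apply: (cvg_limn_einf_sup _).2.
  apply: (@squeeze_cvge _ _ _ _ (fun=> 0%E) _
    (fun n => ((n + c)%:R * ln K.+1%:R / (n ^ 2)%N%:R)%:E)).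
  - apply: nearW => n; have /andP[N1 NK] := Kc n.
    rewrite !lee_fin divr_ge0 ?ln_ge0 //=.
    rewrite ler_wpM2r ?invr_ge0 // mulr_natl -lnXn // -natrX ler_ln ?posrE //.
    exact: lt_le_trans N1.
  - exact: cvg_cst.
  - apply/fine_cvgP; split; first exact: nearW.
    by apply: cvg_linear_over_square; rewrite ln_ge0 ?ler1n.
apply/seteqP; split=> [_ [U Uc <-]|_ ->] /=; first exact: cov0.
exists [set setT]; last first.
  apply: cov0; split; first by move=> _ ->; exact: openT.
  by rewrite bigcup_set1.
by split; [move=> _ ->; exact: openT|rewrite bigcup_set1].
Qed.

End Entropy.

(** * Involutions of the full group *)

Section Swap.
Context (B : countType) (b : B -> Z2 -> bool).
Local Notation X := (set_type (hull b)).
Local Notation orb := (orb b).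
Local Notation alpha := (hull_action b).
Local Notation pt := (hull_pt b).

Section OneMark.
Variable k : B.

(** The bit of [k] at place [(0, j)] is read as a mark on the vertical edge from
[(0, j)] to [(0, j + 1)]. Ignoring marks with a marked neighbour makes the
edges in use pairwise disjoint, so that exchanging their endpoints makes sense
for every array. *)
Definition isolated_mark (x : cantor_space) (j : int) : bool :=
  [&& read x (0, j) k, ~~ read x (0, j - 1) k & ~~ read x (0, j + 1) k].

Definition jump (x : cantor_space) : int :=
  if isolated_mark x 0 then 1 else if isolated_mark x (-1) then -1 else 0.

Definition swap (x : X) : X := alpha (0, jump (val x)) x.

Lemma isolated_mark_translate d x j :
  isolated_mark (translate B (0, d) x) j = isolated_mark x (j + d).
Proof.
have addE j' : (0, j') + (0, d) = (0, j' + d) :> Z2 by [].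
by rewrite /isolated_mark !read_translate !addE (addrAC j (-1)) (addrAC j 1).
Qed.

Lemma isolated_mark_pt g j : isolated_mark (val (pt g)) j =
  [&& b k ((0, j) + g), ~~ b k ((0, j - 1) + g) & ~~ b k ((0, j + 1) + g)].
Proof.
by rewrite /isolated_mark -![read _ _ _]/(read (orb g) _ _) !read_orb.
Qed.

(** After the jump the same edge is seen from its other end. *)
Lemma jump_swap x : jump (val (swap x)) = - jump (val x).
Proof.
rewrite /swap /=; move: (val x) => {}x.
rewrite {1}/jump !isolated_mark_translate !add0r /jump.
have [e0|ne0] := boolP (isolated_mark x 0).
  have -> : isolated_mark x 1 = false.
    by move: e0; rewrite /isolated_mark add0r => /and3P[_ _ /negbTE ->].
  by rewrite addNr e0.
have [e1|ne1] := boolP (isolated_mark x (-1)); first by rewrite e1 opprK.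
by rewrite !addr0 (negbTE ne0) (negbTE ne1) oppr0.
Qed.

Lemma swapK : involutive swap.
Proof.
move=> x; rewrite {1}/swap jump_swap /swap -actD.
have -> : (0, - jump (val x)) + (0, jump (val x)) = 0 :> Z2.
  by congr pair; rewrite /= ?addr0 // addNr.
exact: act0.
Qed.

Lemma jump_agree : exists M, forall x y : cantor_space,
  agree M x y -> jump x = jump y.
Proof.
pose S := [:: 0; 0 - 1; 0 + 1; -1; -1 - 1; -1 + 1] : seq int.
exists (\max_(j <- S) (pickle ((0, j)%R : Z2, k)).+1)%N => x y xy.
have readE j : j \in S -> read x (0, j) k = read y (0, j) k.
  by move=> jS; apply: xy; rewrite (big_rem _ jS) /= leq_maxl.
by rewrite /jump /isolated_mark !readE // !inE eqxx ?orbT.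
Qed.

Lemma swap_continuous : continuous swap.
Proof.
apply: hull_continuousP => N x; have [M1 jM] := jump_agree.
have [M2 sM] := translate_agree B (0, jump (val x)) N.
exists (maxn M1 M2) => y xy; rewrite /swap /=.
rewrite -(jM _ _ (agree_le (leq_maxl _ _) xy)).
exact: sM (agree_le (leq_maxr _ _) xy).
Qed.

Lemma swap_in_full_group : in_full_group alpha swap.
Proof.
split.
  split; first exact: swap_continuous.
  by exists swap; [exact: swap_continuous|split; exact: swapK].
exists (fun x => (0, jump (val x))) => //; apply/continuous_discreteP => x.
have [M jM] := jump_agree.
by apply/hull_nbhsP; exists M => y /jM ->.
Qed.

Definition swap_elt : full_group alpha := exist _ swap swap_in_full_group.

Lemma swap_elt_sq : (swap_elt * swap_elt = 1)%g.
Proof. by apply: full_group_inj => x; exact: swapK. Qed.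

End OneMark.

Section Walk.
Context (L : eqType) (lab : L -> B).

(** The vertical edges above [g] carry the letters of [w] in order; the edges just
before and just after the word carry no letter. *)
Definition spells (w : seq L) (g : Z2) : Prop :=
  (forall l, b (lab l) ((0, -1) + g) = false) /\
  forall l (j : nat), (j <= size w)%N ->
    b (lab l) ((0, j%:Z) + g) = (nth None (map some w) j == Some l).

(** Since adjacent letters differ, the mark above the current place is isolated,
and each letter moves the point up by one. *)
Lemma spells_walk w g : sorted (fun l l' => l != l') w -> spells w g ->
  foldl (fun x l => swap (lab l) x) (pt g) w = pt ((0, (size w)%:Z) + g).
Proof.
move=> sw [bN bP].
have addE (c d : int) : (0, c) + (0, d) = (0, c + d) :> Z2 by [].
have ne (j : nat) l l' : nth None (map some w) j = Some l ->
    nth None (map some w) j.+1 = Some l' -> l != l'.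
  have [jw|wj _] := ltnP j.+1 (size w); last by rewrite nth_default // size_map.
  rewrite !(nth_map l) // 1?ltnW // => -[{2}<-] [<-].
  by move/(sortedP l): sw; apply.
have step (j : nat) l : (j < size w)%N -> nth None (map some w) j = Some l ->
    swap (lab l) (pt ((0, j%:Z) + g)) = pt ((0, j.+1%:Z) + g).
  move=> jw wj; rewrite /swap /jump.
  suff -> : isolated_mark (lab l) (val (pt ((0, j%:Z) + g))) 0.
    by rewrite hull_action_pt addrA addE.
  rewrite isolated_mark_pt !addrA !addE !add0r.
  rewrite bP 1?ltnW // wj eqxx /=; apply/andP; split.
    case: j jw wj => [|j] jw wj; first by rewrite addr0 bN.
    rewrite (_ : -1 + j.+1%:Z = j%:Z); last by lia.
    rewrite bP; last by lia.
    by apply/eqP => wj'; have := ne _ _ _ wj' wj; rewrite eqxx.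
  rewrite (_ : 1 + j%:Z = j.+1%:Z); last by lia.
  by rewrite bP //; apply/eqP => wj'; have := ne _ _ _ wj wj'; rewrite eqxx.
suff H (j : nat) : (j <= size w)%N ->
    foldl (fun x l => swap (lab l) x) (pt g) (take j w) = pt ((0, j%:Z) + g).
  by have := H _ (leqnn _); rewrite take_size.
elim: j => [_|j IH jw]; first by rewrite take0 /= (_ : (0, 0%:Z) = 0 :> Z2) ?add0r.
have [l wl] : exists l, nth None (map some w) j = Some l.
  by case: w jw {sw bP ne step IH} => // l w' jw; exists (nth l (l :: w') j);
    rewrite (nth_map l).
have wl' : nth l w j = l by move: wl; rewrite (nth_map l) // => -[].
by rewrite (take_nth l) // foldl_rcons wl' IH ?(ltnW jw) // step.
Qed.

End Walk.
End Swap.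

(** * Free groups from nontrivial reduced words *)

Section Words.
Local Open Scope group_scope.

(** A letter is a generator together with an exponent sign, [true] for [+1]. *)
Definition letter_inv (l : bool * bool) := (l.1, ~~ l.2).

Definition reduced (w : seq (bool * bool)) :=
  sorted (fun l l' => l' != letter_inv l) w.

Section Eval.
Context (H : groupType) (x : bool -> H).

Definition letter_eval (l : bool * bool) : H :=
  if l.2 then x l.1 else (x l.1)^-1.

Definition word_eval (w : seq (bool * bool)) : H :=
  foldr (fun l a => letter_eval l * a) 1 w.

Lemma eval_cat u v : word_eval (u ++ v) = word_eval u * word_eval v.
Proof. by elim: u => [|l u IH] /=; rewrite ?mul1g // IH mulgA. Qed.

Lemma letter_evalV l : letter_eval (letter_inv l) = (letter_eval l)^-1.
Proof. by case: l => s [] //=; rewrite /letter_eval /= invgK. Qed.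

Lemma eval_cancel u l v :
  word_eval (u ++ [:: l, letter_inv l & v]) = word_eval (u ++ v).
Proof. by rewrite !eval_cat /= letter_evalV mulVKg. Qed.

Definition word_inv w := rev (map letter_inv w).

Lemma eval_inv w : word_eval (word_inv w) = (word_eval w)^-1.
Proof.
elim: w => [|l w IH] /=; first by rewrite invg1.
by rewrite /word_inv /= rev_cons -cats1 eval_cat -/(word_inv w) IH /= mulg1
  letter_evalV invgM.
Qed.

End Eval.

Lemma morph_eval (H K : groupType) (f : {multiplicative H -> K})
  (x : bool -> H) w : f (word_eval x w) = word_eval (f \o x) w.
Proof.
have f1 : f 1 = 1 by apply: (mulgI (f 1)); rewrite -gmulfM !mulg1.
elim: w => [//|[s e] w IH] /=; rewrite gmulfM IH; congr (_ * _).
case: e => //; rewrite /letter_eval /=.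
by apply/esym/mulg1_eq; rewrite -gmulfM mulgV.
Qed.

Lemma reducedPn w : ~~ reduced w ->
  exists u l v, w = u ++ [:: l, letter_inv l & v].
Proof.
elim: w => [|l [|l' w] IH] //=; rewrite negb_and negbK => /orP[/eqP ->|/IH].
  by exists [::], l, w.
by move=> [u [m [v ->]]]; exists (l :: u), m, v.
Qed.

Definition faithful_on_reduced (H : groupType) (x : bool -> H) :=
  forall w, reduced w -> w != [::] -> word_eval x w <> 1.

(** A nonempty word that is trivial at [x] is not reduced, and cancelling a pair
of inverse letters changes its value in no group; induct on the length. *)
Lemma relation_universal (H K : groupType) (x : bool -> H) (y : bool -> K) w :
  faithful_on_reduced x -> word_eval x w = 1 -> word_eval y w = 1.
Proof.
move=> fx; elim: {w}(size w) {-2}w (leqnn (size w)) => [|n IH] w.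
  by rewrite leqn0 size_eq0 => /eqP ->.
have [red_w _|/reducedPn[u [l [v ->]]]] := boolP (reduced w).
  by have [->//|/(fx w red_w)] := eqVneq w [::].
rewrite !eval_cancel => szw; apply: IH.
by move: szw; rewrite !size_cat /= !addnS => /ltnW.
Qed.

Lemma eval_eq (H K : groupType) (x : bool -> H) (y : bool -> K) w w' :
  faithful_on_reduced x -> word_eval x w = word_eval x w' ->
  word_eval y w = word_eval y w'.
Proof.
move=> fx ww'; apply: divg1_eq; rewrite -eval_inv -eval_cat.
by apply: (relation_universal y fx); rewrite eval_cat eval_inv ww' mulgV.
Qed.

Section Generated.
Context (H : groupType) (x : bool -> H).

Definition generated : {pred H} := fun h => `[< exists w, h = word_eval x w >].

Lemma generated_closed : group_closed generated.
Proof.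
split; first by apply/asboolP; exists [::].
move=> _ _ /asboolP[u ->] /asboolP[v ->]; apply/asboolP.
by exists (u ++ word_inv v); rewrite eval_cat eval_inv.
Qed.

Record generated_group := Generated {
  generated_val : H; generated_valP : generated_val \in generated }.

HB.instance Definition _ := [isSub for generated_val].
HB.instance Definition _ := [Choice of generated_group by <:].
HB.instance Definition _ := SubChoice_isSubGroup.Build
  H generated generated_group generated_closed.

Lemma generated_valM : {morph generated_val : a b / a * b}.
Proof. exact: monoid.valM. Qed.

HB.instance Definition _ :=
  isMultiplicative.Build generated_group H generated_val generated_valM.

Lemma gen_subproof s : x s \in generated.
Proof. by apply/asboolP; exists [:: (s, true)]; rewrite /= mulg1. Qed.

Definition gen s : generated_group := Generated (gen_subproof s).

Lemma generated_word (a : generated_group) :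
  exists w, generated_val a = word_eval x w.
Proof. exact/asboolP/(valP a). Qed.

Definition chosen_word a := sval (cid (generated_word a)).

Lemma eval_chosen_word a : word_eval x (chosen_word a) = generated_val a.
Proof. by rewrite /chosen_word; case: cid. Qed.

Lemma generated_val_eval w : generated_val (word_eval gen w) = word_eval x w.
Proof. exact: (morph_eval generated_val). Qed.

Lemma eval_gen_word a : word_eval gen (chosen_word a) = a.
Proof. by apply: val_inj; rewrite /= generated_val_eval eval_chosen_word. Qed.

Hypothesis fx : faithful_on_reduced x.

Section Extension.
Context (K : groupType) (y : bool -> K).

Definition extension (a : generated_group) : K := word_eval y (chosen_word a).

Lemma extensionM : {morph extension : a b / a * b}.
Proof.
move=> a b; rewrite -eval_cat; apply: (eval_eq y fx).
by rewrite eval_cat !eval_chosen_word generated_valM.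
Qed.

HB.instance Definition _ :=
  isMultiplicative.Build generated_group K extension extensionM.

Lemma extension_gen s : extension (gen s) = y s.
Proof.
rewrite -[RHS]mulg1 -[RHS]/(word_eval y [:: (s, true)]); apply: (eval_eq y fx).
by rewrite eval_chosen_word /= mulg1.
Qed.
End Extension.

(** Evaluating at [y] any word that represents an element is well defined by
[eval_eq], which avoids normal forms. *)
Lemma generated_free : free_group generated_group.
Proof.
exists (range gen) => K f; exists (extension (f \o gen)).
  by move=> _ [s _ <-]; exact: extension_gen.
move=> h hf a; rewrite -[a in LHS]eval_gen_word morph_eval /extension.
congr word_eval; apply/funext => s; apply: hf; exact: imageP.
Qed.

(** The commutator of the generators is a reduced word. *)
Lemma generated_nonabelian : ~ abelian_group generated_group.
Proof.
move=> ab; have := ab (gen true) (gen false) => /(congr1 generated_val).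
rewrite !generated_valM /= => E.
apply: (fx
  (w := [:: (true, true); (false, true); (true, false); (false, false)])) => //.
by rewrite /= /letter_eval /= mulg1 mulgA E -invgM mulgV.
Qed.

Lemma generated_embeds : embeds_in generated_group H.
Proof. by exists (val : generated_group -> H); exact: val_inj. Qed.

End Generated.
End Words.

(** * A free pair in the full group *)

Lemma invgM_involutions (H : groupType) (a c : H) :
  (a * a = 1 -> c * c = 1 -> (a * c)^-1 = c * a)%g.
Proof. by move=> aa cc; apply: mulg1_eq; rewrite -mulgA (mulgA c) cc mul1g. Qed.

Section FreeSwaps.
Context (B : countType) (b : B -> Z2 -> bool) (lab : bool * bool -> B).
Local Notation alpha := (hull_action b).
Local Notation pt := (hull_pt b).
Local Open Scope group_scope.

(** The marks are indexed by pairs of booleans, and generator [s] is the product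
of the two involutions with first index [s]. Its inverse is their product in the
opposite order, so that a letter becomes a pair of distinct marks ending in the
letter itself. *)
Definition swap_gen (s : bool) : full_group alpha :=
  swap_elt b (lab (s, false)) * swap_elt b (lab (s, true)).

Definition letter_marks (l : bool * bool) := [:: letter_inv l; l].

Definition marks (w : seq (bool * bool)) := flatten (map letter_marks w).

Lemma swap_genV s : (swap_gen s)^-1 =
  swap_elt b (lab (s, true)) * swap_elt b (lab (s, false)).
Proof. by apply: invgM_involutions; exact: swap_elt_sq. Qed.

Lemma eval_marks w x : sval (word_eval swap_gen w) x =
  foldr (fun m y => swap (lab m) y) x (marks w).
Proof.
elim: w => [//|[s e] w IH]; rewrite /marks /= -/(marks w) -IH /letter_inv /=.
by case: e; rewrite /letter_eval /= ?swap_genV.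
Qed.

(** The last mark of a letter equals the first mark of the next letter exactly
when the two letters are inverse to each other. *)
Lemma sorted_marks w : reduced w -> sorted (fun m m' => m != m') (marks w).
Proof.
elim: w => [//|l [|l' w] IH] /= red_w.
  by case: l red_w => [[] []].
case/andP: red_w => ll' red_w; rewrite [X in [&& _, _ & X]]IH // andbT.
apply/andP; split; first by case: (l) => [[] []].
by move: ll'; case: (l) (l') => [[] []] [[] []].
Qed.

(** The involution of the last mark acts first, so the walk follows a column that
spells the marks in reverse order; it ends at another place, which is another
point since the action is free. *)
Lemma swap_gen_free : separating b ->
  (forall w : seq (bool * bool), exists g, spells b lab w g) ->
  faithful_on_reduced swap_gen.
Proof.
move=> sep spell w red_w w0 /(congr1 sval) E.
have [g gw] := spell (rev (marks w)).
have := congr1 (fun f => f (pt g)) E; rewrite eval_marks /=.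
rewrite -(foldl_rev (fun y m => swap (lab m) y)) (spells_walk _ gw); last first.
  rewrite rev_sorted; apply: sub_sorted (sorted_marks red_w) => m m'.
  by rewrite eq_sym.
move=> /(pt_inj sep)/eqP; rewrite -subr_eq0 addrK.
by case: w w0 {red_w E gw} => // l w _; rewrite size_rev.
Qed.

End FreeSwaps.

(** * A Toeplitz array on Z^2 *)

Local Notation tri m := (3 ^ m)%N.

(** [2 * i + 1] never vanishes, so [i] has finite depth: the 3-adic number -1/2,
at which the depth would be infinite, is not an integer. *)
Definition depth (i : int) : nat := logn 3 (absz (2 * i + 1)).

Definition digit (n j : nat) : nat := (n %/ 5 ^ j) %% 5.

Definition residue (d : nat) (i : int) : nat := absz (i %% (tri d)%:Z)%Z.

(** Column [i] reads off the base 5 digits of its depth, periodically. For a depth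
[n] all digits from position [n] on vanish, hence each period [3 ^ n] is long
enough to show the whole expansion and at least one blank, the digit 0. *)
Definition label (i j : int) : nat := digit (depth i) (residue (depth i) j).

Lemma residueP d i i' :
  (residue d i = residue d i') <-> ((tri d)%:Z %| i - i')%Z.
Proof.
have d0 : (tri d)%:Z != 0 by rewrite eqz_nat -lt0n expn_gt0.
rewrite /residue -eqz_mod_dvd; split=> [rr|/eqP->//]; apply/eqP.
by have [] := (modz_ge0 i d0, modz_ge0 i' d0); lia.
Qed.

Lemma residue_lt d i : (residue d i < tri d)%N.
Proof.
have d0 : (tri d)%:Z != 0 by rewrite eqz_nat -lt0n expn_gt0.
have d1 : 0 < (tri d)%:Z by rewrite ltz_nat expn_gt0.
have := ltz_pmod i d1; have := modz_ge0 i d0; rewrite /residue; lia.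
Qed.

Lemma residue_le d m i i' : (d <= m)%N ->
  residue m i = residue m i' -> residue d i = residue d i'.
Proof.
move=> dm /residueP ii'; apply/residueP; apply: dvdz_trans ii'.
by rewrite dvdzE !absz_nat dvdn_exp2l.
Qed.

Lemma residueD d a i i' : residue d i = residue d i' ->
  residue d (a + i) = residue d (a + i').
Proof.
by move=> /residueP ii'; apply/residueP; rewrite opprD addrACA subrr add0r.
Qed.

Lemma leq_depth m i : (m <= depth i)%N = ((tri m)%:Z %| 2 * i + 1)%Z.
Proof.
have i0 : (0 < absz (2 * i + 1)%R)%N by lia.
by rewrite dvdzE absz_nat pfactor_dvdn.
Qed.

Lemma leq_depth_congr m i i' : residue m i = residue m i' ->
  (m <= depth i)%N = (m <= depth i')%N.
Proof.
move=> /residueP ii'; rewrite !leq_depth.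
rewrite (_ : 2 * i + 1 = 2 * (i - i') + (2 * i' + 1)); last by ring.
by rewrite rpredDl ?dvdz_mull.
Qed.

Lemma depth_congr m i i' : (depth i < m)%N -> residue m i = residue m i' ->
  depth i' = depth i.
Proof.
move=> im ii'; apply/eqP; rewrite eqn_leq.
rewrite -(leq_depth_congr (residue_le (ltnW im) ii')) leqnn andbT leqNgt.
by rewrite -(leq_depth_congr (residue_le im ii')) ltnn.
Qed.

(** A column of depth less than [m] also has a period dividing [3 ^ m]. *)
Lemma label_congr m i j i' j' : (depth i < m)%N ->
  residue m i = residue m i' -> residue m j = residue m j' ->
  label i j = label i' j'.
Proof.
move=> im ii' jj'; rewrite /label (depth_congr im ii').
by congr digit; apply: residue_le jj'; exact: ltnW.
Qed.

Lemma label_lt i j : (label i j < 5)%N.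
Proof. by rewrite ltn_mod. Qed.

(** [inl (second, d, r)] asks whether a coordinate is [r] modulo [3 ^ d], and
[inr l] whether the label is the mark [l]. *)
Definition observable : countType := ((bool * nat * nat) + (bool * bool))%type.

(** The marks take the digits 1 to 4, leaving 0 for the blank. *)
Definition mark_code (l : bool * bool) : nat := ((l.1 : nat).*2 + l.2).+1.

Definition obs (k : observable) (g : Z2) : bool :=
  match k with
  | inl (second, d, r) => residue d (if second then g.2 else g.1) == r
  | inr l => label g.1 g.2 == mark_code l
  end.

Definition level (k : observable) : nat := if k is inl (_, d, _) then d else 0.

Lemma obs_congr m k g g' : (level k <= m)%N -> (depth g.1 < m)%N ->
  residue m g.1 = residue m g'.1 -> residue m g.2 = residue m g'.2 ->
  obs k g = obs k g'.
Proof.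
case: k => [[[[] d] r]|l] /= km gm g1 g2.
- by rewrite (residue_le km g2).
- by rewrite (residue_le km g1).
- by rewrite (label_congr gm g1 g2).
Qed.

Lemma obs_toeplitz : toeplitz obs.
Proof.
move=> k g; exists (tri (maxn (level k) (depth g.1).+1)) => [|h].
  by rewrite expn_gt0.
set m := maxn _ _.
have per (c d : int) : residue m c = residue m (c + d *+ tri m).
  by apply/residueP; rewrite opprD addNKr rpredN -mulr_natr natz dvdz_mull.
apply/esym/(@obs_congr m); rewrite ?leq_maxl ?leq_maxr //.
- by rewrite pairMnE; exact: per.
- by rewrite pairMnE; exact: per.
Qed.

Lemma obs_separating : separating obs.
Proof.
move=> [a1 a2] a0; pose d := (`|a1| + `|a2|)%N.
exists ([seq inl (false, d, r) | r <- iota 0 (tri d)] ++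
        [seq inl (true, d, r) | r <- iota 0 (tri d)]) => -[i j].
have far (c i' : int) : (`|c| <= d)%N -> c != 0 ->
    residue d (c + i') != residue d i'.
  move=> cd c0; apply/eqP => /residueP; rewrite addrK dvdzE absz_nat => /dvdn_leq.
  have := ltn_expl d (isT : 1 < 3)%N; lia.
have [a10|a10] := eqVneq a1 0.
  have a20 : a2 != 0 by apply/eqP => a20; apply: a0; rewrite a10 a20.
  exists (inl (true, d, residue d j)).
    by rewrite mem_cat map_f ?orbT // mem_iota /= residue_lt.
  by rewrite /= eqxx; apply/negP; apply: far; rewrite // leq_addl.
exists (inl (false, d, residue d i)).
  by rewrite mem_cat map_f // mem_iota /= residue_lt.
by rewrite /= eqxx; apply/negP; apply: far; rewrite // leq_addr.
Qed.

(** * Counting the patterns of the array *)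

(** The observables to be predicted sit at distance at most [r] from a box of side
[n], so the window starts at [g - (r, r)]; the side [m] exceeds by one the
number [n + 2 * r] of positions that occur. *)
Section Patterns.
Variables r n : nat.
Let m := (n + (2 * r).+1)%N.

Definition deep_column (i : int) : option 'I_m :=
  [pick s : 'I_m | (m <= depth (i - r%:Z + (s : nat)%:Z))%N].

Definition deep_labels (g : Z2) : {ffun 'I_m -> 'I_5} :=
  [ffun t : 'I_m => if deep_column g.1 is Some s then
     inord (label (g.1 - r%:Z + (s : nat)%:Z) (g.2 - r%:Z + (t : nat)%:Z))
   else ord0].

Definition pattern_data (g : Z2) :
    'I_(tri m) * 'I_(tri m) * {ffun 'I_m -> 'I_5} :=
  (Ordinal (residue_lt m g.1), Ordinal (residue_lt m g.2), deep_labels g).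

Lemma deep_column_congr i i' : residue m i = residue m i' ->
  deep_column i = deep_column i'.
Proof.
move=> ii'; apply: eq_pick => s /=.
by apply: leq_depth_congr; rewrite -!addrA ![_ + (- _ + _)]addrC; exact: residueD.
Qed.

(** Two columns of depth at least [m] differ by a multiple of [3 ^ m], which
exceeds the window. *)
Lemma deep_column_uniq i i' : (m <= depth i)%N -> (m <= depth i')%N ->
  (`|i - i'| < m)%N -> i = i'.
Proof.
rewrite !leq_depth => di di' close.
have : ((tri m)%:Z %| 2 * (i - i'))%Z.
  rewrite (_ : 2 * (i - i') = (2 * i + 1) - (2 * i' + 1)); last by ring.
  exact: rpredB.
rewrite Gauss_dvdzr; last by rewrite coprimezE absz_nat coprimeXl.
rewrite dvdzE absz_nat => /dvdn_leq lem.
apply/eqP; rewrite -subr_eq0 -absz_eq0 -leqn0 leqNgt; apply/negP => /lem.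
have := ltn_expl m (isT : 1 < 3)%N; lia.
Qed.

Lemma deep_labelsE (g : Z2) (h1 h2 : int) :
  - r%:Z <= h1 < (n + r)%N%:Z -> - r%:Z <= h2 < (n + r)%N%:Z ->
  (m <= depth (h1 + g.1))%N ->
  forall g', pattern_data g = pattern_data g' ->
    label (h1 + g.1) (h2 + g.2) = label (h1 + g'.1) (h2 + g'.2).
Proof.
move=> h1r h2r deep g' [gg1 gg2] /ffunP E.
have ordE (h : int) : - r%:Z <= h < (n + r)%N%:Z ->
    exists s : 'I_m, forall c, c - r%:Z + (s : nat)%:Z = h + c.
  move=> hr; have sm : (absz (h + r%:Z)%R < m)%N by rewrite /m; lia.
  by exists (Ordinal sm) => c /=; lia.
have [s sE] := ordE _ h1r; have [t tE] := ordE _ h2r.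
have col : deep_column g.1 = Some s.
  rewrite /deep_column; case: pickP => [s'|/(_ s)]; last first.
    by rewrite sE deep.
  move=> deep'; congr Some; apply: ord_inj.
  have lts := ltn_ord s; have lts' := ltn_ord s'.
  have := @deep_column_uniq _ _ deep' deep; rewrite -sE.
  move=> H; have : g.1 - r%:Z + (s' : nat)%:Z = g.1 - r%:Z + (s : nat)%:Z.
    by apply: H; lia.
  lia.
have := E t; rewrite !ffunE -(deep_column_congr gg1) col !sE !tE => /(congr1 val).
by rewrite /= !inordK ?label_lt.
Qed.

End Patterns.

(** There are [3 ^ m * 3 ^ m * 5 ^ m = 45 ^ m] values of [pattern_data]. *)
Lemma obs_low_complexity : low_complexity obs.
Proof.
move=> S.
have [r rP] : exists r : nat, forall u k, (u, k) \in S ->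
    [/\ (`|u.1| <= r)%N, (`|u.2| <= r)%N & (level k <= r)%N].
  exists (\max_(p <- S) (absz p.1.1 + absz p.1.2 + level p.2))%N => u k uk.
  rewrite (big_rem _ uk) /=.
  by split; rewrite leq_max; apply/orP; left; lia.
(* [44.+1] is 3 * 3 * 5 *)
exists 44%N, (2 * r).+1 => n.
exists ('I_(tri (n + (2 * r).+1)) * 'I_(tri (n + (2 * r).+1)) *
   {ffun 'I_(n + (2 * r).+1) -> 'I_5})%type, (@pattern_data r n).
split; first by rewrite !card_prod card_ffun !card_ord -!expnMn.
move=> g g' gg' h /andP[h1 h2] u k /rP[u1 u2 kr].
have [gg1 gg2 _] := gg'.
pose m := (n + (2 * r).+1)%N.
have r1 : residue m (u + (h + g)).1 = residue m (u + (h + g')).1.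
  by do 2 apply: residueD.
have r2 : residue m (u + (h + g)).2 = residue m (u + (h + g')).2.
  by do 2 apply: residueD.
have [shallow|deep] := ltnP (depth (u + (h + g)).1) m.
  by apply: obs_congr shallow r1 r2; rewrite /m; lia.
case: k kr => [[[second d] x] /= dr|l _].
  have dm : (d <= m)%N by rewrite /m; lia.
  by case: second; congr (_ == _);
    [exact: residue_le dm r2|exact: residue_le dm r1].
have near (a c : int) : (absz a <= r)%N -> 0 <= c < n%:Z ->
    - r%:Z <= a + c < (n + r)%N%:Z by lia.
congr (_ == _); rewrite /= in deep u1 u2 h1 h2 *; rewrite !addrA in deep *.
apply: (@deep_labelsE r n g (u.1 + h.1) (u.2 + h.2)) gg' => //; exact: near.
Qed.

(** * Every word occurs in a column *)

Definition code_word (w : seq (bool * bool)) : nat :=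
  foldr (fun l a => mark_code l + 5 * a)%N 0%N w.

Lemma mark_code_bounds l : (0 < mark_code l < 5)%N.
Proof. by case: l => [[] []]. Qed.

Lemma mark_code_inj : injective mark_code.
Proof. by move=> [[] []] [[] []]. Qed.

Lemma digit_code_word w j : digit (code_word w) j = nth 0%N (map mark_code w) j.
Proof.
elim: w j => [|l w IH] j; first by rewrite nth_nil /digit div0n mod0n.
have /andP[_ l5] := mark_code_bounds l.
case: j => [|j] /=; rewrite /digit.
  by rewrite expn0 divn1 addnC mulnC modnMDl modn_small.
rewrite expnS divnMA addnC [(5 * _)%N]mulnC divnMDl // (divn_small l5) addn0.
exact: IH.
Qed.

Lemma size_code_word w : (size w <= code_word w)%N.
Proof.
elim: w => //= l w IH; have /andP[l0 _] := mark_code_bounds l; lia.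
Qed.

(** If [n] codes [w] then column [(3 ^ n - 1) / 2] has depth [n]. The period
[3 ^ n] exceeds the length of [w], so the word is preceded and followed by a
blank. *)
Lemma obs_spells (w : seq (bool * bool)) : exists g,
  spells obs (inr : _ -> observable) w g.
Proof.
set n := code_word w.
have odd_tri : odd (tri n) by rewrite oddX orbT.
have dE : depth ((tri n)./2)%:Z = n.
  rewrite /depth (_ : absz _ = tri n) ?pfactorK //.
  have := odd_double_half (tri n); rewrite odd_tri; lia.
have wn : (size w < tri n)%N.
  exact: leq_ltn_trans (size_code_word w) (ltn_expl _ _).
have digitE j l : (digit n j == mark_code l) =
    (nth None (map some w) j == Some l).
  rewrite digit_code_word.
  have [jw|wj] := ltnP j (size w).
    by rewrite !(nth_map l) // (inj_eq mark_code_inj).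
  rewrite !nth_default ?size_map //; have := mark_code_bounds l; lia.
exists ((tri n)./2%:Z, 0); split=> [l|l j jw] /=.
  rewrite add0r addr0 /label dE digitE (_ : residue n (-1) = (tri n).-1).
    by rewrite nth_default // size_map; lia.
  rewrite /residue; case: (tri n) (expn_gt0 3 n) => // t _.
  rewrite (_ : -1 = -1 * t.+1%:Z + t%:Z); last first.
    by rewrite -addn1 PoszD mulN1r opprD addrC addNKr.
  by rewrite modzMDl modz_small //; lia.
rewrite add0r addr0 /label dE digitE (_ : residue n j%:Z = j) //.
by rewrite /residue modz_small // ltz_nat (leq_ltn_trans jw wn).
Qed.

Theorem theoremB (R : realType) :
  exists (X : topologicalType) (alpha : cts_action (int * int)%type X),
    [/\ is_cantor_set X,
        minimal_action alpha,
        free_action alpha,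
        topological_entropy R alpha = 0%E &
        exists F : groupType,
          [/\ free_group F, ~ abelian_group F & embeds_in F (full_group alpha)]].
Proof.
exists (set_type (hull obs)), (hull_action obs); split.
- exact: hull_cantor R obs_toeplitz obs_separating.
- exact: hull_minimal obs_toeplitz.
- exact: hull_free obs_separating.
- exact: hull_entropy obs_low_complexity.
have fr := swap_gen_free obs_separating obs_spells.
exists (generated_group (swap_gen obs (inr : _ -> observable))); split.
- exact: generated_free.
- exact: generated_nonabelian.
- exact: generated_embeds.
Qed.
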